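(* Let $H\in\mathcal{H}^+$ be a positive-Horn expression, let $h$ be any positive occurrence (an occurrence of an element of $\mathcal{L}\cup\{\bot\}$ not under an overline) in $H$, and let $\Delta(H,h)$ be its associated expression. Then for every interpretation $I$, $$H^I\models \big(\textstyle\bigvee(h\ \ \Delta(H,h))\big)^I .$$
   Context: Fix a set $\mathcal{A}$ of propositional atoms; $\mathcal{L}=\mathcal{A}\cup\{\neg a:a\in\mathcal{A}\}$ is the set of literals; for $\ell\in\mathcal{L}$, $\mathit{not}\,\ell$ is a default literal. Elementary expressions: $\mathcal{E}^1=\mathcal{L}\cup\{\mathit{not}\,\ell:\ell\in\mathcal{L}\}\cup\{\top,\bot\}$. For each $x\in\mathcal{E}^1$ there is a negative (overlined) elementary expression $\overline{x}$. Expressions are built from elementary and overlined elementary expressions with the connectives $\bigwedge[\varphi_1\ldots\varphi_k]$ and $\bigvee(\varphi_1\ldots\varphi_k)$. An interpretation is a set $I\subseteq\mathcal{L}$ containing no pair $a,\neg a$. Satisfaction: $I\models\top$, $I\not\models\bot$; $I\models\ell$ iff $\ell\in I$; $I\models\mathit{not}\,\ell$ iff $\ell\notin I$; $I\models\overline{x}$ iff $I\not\models x$; $I\models\bigwedge[\ldots]$ iff $I$ satisfies all conjuncts; $I\models\bigvee(\ldots)$ iff $I$ satisfies some disjunct. Reduct w.r.t. $I$: $x^I=x$ for $x\in\mathcal{L}\cup\{\top,\bot\}$; $(\mathit{not}\,\ell)^I=\bot$ if $\ell\in I$ and $\top$ otherwise; $(\overline{x})^I=\overline{x^I}$; reducts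 commute with $\bigwedge,\bigvee$. For expressions $\varphi,\psi$ without default literals, $\varphi\models\psi$ means every interpretation satisfying $\varphi$ satisfies $\psi$. Positive elements are the members of $\mathcal{L}\cup\{\bot\}$. $\mathcal{N}$ is the set of fully negative expressions: those built by $\bigwedge,\bigvee$ in which every elementary occurrence is overlined. The class $\mathcal{H}^+$ of positive-Horn expressions is the smallest set such that: (1) $\mathcal{L}\cup\{\bot\}\subseteq\mathcal{H}^+$; (2) if $\varphi_1,\ldots,\varphi_k\in\mathcal{H}^+$ then $\bigwedge[\varphi_1\ldots\varphi_k]\in\mathcal{H}^+$; (3) if for some $i$, $\varphi_i\in\mathcal{H}^+$ and $\varphi_j\in\mathcal{N}$ for all $j\neq i$, then $\bigvee(\varphi_1\ldots\varphi_k)\in\mathcal{H}^+$. For $H\in\mathcal{H}^+$ and a fixed positive occurrence $h$ in $H$, $\Delta(H,h)$ is defined recursively: if $H$ is this occurrence itself, $\Delta(H,h)=\bot$; if $H=\bigwedge[H_1\ldots H_k]$ and the occurrence lies in $H_i$, $\Delta(H,h)=\Delta(H_i,h)$; if $H=\bigvee(H_1\ldots H_k)$ and the occurrence lies in $H_i$, $\Delta(H,h)=\bigvee(H_1\ldots H_{i-1}\ \Delta(H_i,h)\ H_{i+1}\ldots H_k)$. *)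

(* Defs.v *)
From mathcomp Require Import all_boot.
From mathcomp Require Import boolp classical_sets.

Set Implicit Arguments.
Unset Strict Implicit.
Unset Printing Implicit Defensive.

Variant literal (A : Type) : Type :=
| PosLit of A
| NegLit of A.

Variant elementary (A : Type) : Type :=
| Lit of literal A
| NotLit of literal A
| Top
| Bot.

Arguments Top {A}.
Arguments Bot {A}.

(* Overlining applies to elementary expressions only, so an overlined one is a
   leaf.  The connectives take argument lists of any length, the empty one
   included. *)
Inductive expr (A : Type) : Type :=
| Elem of elementary A
| Over of elementary A
| And of seq (expr A)
| Or of seq (expr A).

Definition interpretation (A : Type) (I : set (literal A)) : Prop :=
  forall a : A, ~ (I (PosLit a) /\ I (NegLit a)).

Definition sat_elementary (A : Type) (I : set (literal A)) (x : elementary A)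
    : Prop :=
  match x with
  | Lit l => I l
  | NotLit l => ~ I l
  | Top => True
  | Bot => False
  end.

Fixpoint sat (A : Type) (I : set (literal A)) (phi : expr A) : Prop :=
  match phi with
  | Elem x => sat_elementary I x
  | Over x => ~ sat_elementary I x
  | And s => foldr and True [seq sat I psi | psi <- s]
  | Or s => foldr or False [seq sat I psi | psi <- s]
  end.

Definition reduct_elementary (A : Type) (I : set (literal A))
    (x : elementary A) : elementary A :=
  match x with
  | NotLit l => if `[< I l >] then Bot else Top
  | _ => x
  end.

Fixpoint reduct (A : Type) (I : set (literal A)) (phi : expr A) : expr A :=
  match phi with
  | Elem x => Elem (reduct_elementary I x)
  | Over x => Over (reduct_elementary I x)
  | And s => And [seq reduct I psi | psi <- s]
  | Or s => Or [seq reduct I psi | psi <- s]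
  end.

(* Meant for expressions without default literals, such as reducts. *)
Definition entails (A : Type) (phi psi : expr A) : Prop :=
  forall J : set (literal A), interpretation J -> sat J phi -> sat J psi.

Definition positive_element (A : Type) (x : elementary A) : bool :=
  match x with
  | Lit _ | Bot => true
  | NotLit _ | Top => false
  end.

Fixpoint fully_negative (A : Type) (phi : expr A) : bool :=
  match phi with
  | Elem _ => false
  | Over _ => true
  | And s | Or s => all (@fully_negative A) s
  end.

Inductive positive_Horn (A : Type) : expr A -> Prop :=
| PositiveHornElem (x : elementary A) :
    positive_element x -> positive_Horn (Elem x)
| PositiveHornAnd (s : seq (expr A)) :
    (forall i phi, onth s i = Some phi -> positive_Horn phi) ->
    positive_Horn (And s)
| PositiveHornOr (s : seq (expr A)) (i : nat) (phi : expr A) :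
    onth s i = Some phi -> positive_Horn phi ->
    (forall j psi, j != i -> onth s j = Some psi -> fully_negative psi) ->
    positive_Horn (Or s).

(* An occurrence in an expression is given by its position: the sequence of
   argument indices, counted from 0, leading to it from the root. *)
Fixpoint subexpr_at (A : Type) (H : expr A) (p : seq nat) : option (expr A) :=
  match p, H with
  | [::], _ => Some H
  | i :: q, (And s | Or s) =>
      if onth s i is Some Hi then subexpr_at Hi q else None
  | _ :: _, (Elem _ | Over _) => None
  end.

(* Positions do not go below an overline, so an element found at a position
   as [Elem h] is not overlined. *)
Definition positive_occurrence (A : Type) (H : expr A) (p : seq nat)
    (h : elementary A) : Prop :=
  positive_element h /\ subexpr_at H p = Some (Elem h).

(* Only meaningful when [p] is the position of a positive occurrence in [H];
   the [Elem Bot] of the out-of-range cases is a dummy. *)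
Fixpoint Delta (A : Type) (H : expr A) (p : seq nat) : expr A :=
  match p, H with
  | [::], _ => Elem Bot
  | i :: q, And s =>
      if onth s i is Some Hi then Delta Hi q else Elem Bot
  | i :: q, Or s =>
      if onth s i is Some Hi then Or (set_nth (Elem Bot) s i (Delta Hi q))
      else Elem Bot
  | _ :: _, (Elem _ | Over _) => Elem Bot
  end.

(* Main.v *)
(* Positions never go below an overline, and conjunction and disjunction are
   monotone.  Hence, by induction on the position, satisfying [H] forces [h] or
   what remains of [H] once [h] is replaced by [Bot] in the disjunctions above
   it. *)
Require Import Defs.
From mathcomp Require Import all_boot.
From mathcomp Require Import boolp classical_sets.

Lemma foldr_and_onth (T : Type) (P : T -> Prop) (s : seq T) (i : nat) (x : T) :
  foldr and True [seq P y | y <- s] -> onth s i = Some x -> P x.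
Proof.
elim: s i => [|y s IHs] [|i] //= [Py Ps]; first by case=> <-.
exact: IHs.
Qed.

(** A true disjunct is either the entry [x] about to be overwritten or one that the update leaves in
    place. *)
Lemma foldr_or_set_nth (T : Type) (P : T -> Prop) (s : seq T) (i : nat)
    (x0 x y : T) :
  foldr or False [seq P z | z <- s] -> onth s i = Some x ->
  P x \/ foldr or False [seq P z | z <- set_nth x0 s i y].
Proof.
elim: s i => [|z s IHs] [|i] //= Pzs.
- by case=> <-; case: Pzs; [left | right; right].
- by case: Pzs => [Pz _|Ps sx]; [right; left | case: (IHs i Ps sx); auto].
Qed.

Lemma foldr_or_set_nth_id (T : Type) (P : T -> Prop) (s : seq T) (i : nat)
    (x0 y : T) :
  P y -> foldr or False [seq P z | z <- set_nth x0 s i y].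
Proof.
move=> Py; elim: s i => [|z s IHs] [|i] /=; try by left.
(* Past the end of [s], [set_nth] pads with [x0] and puts [y] after the padding. *)
- by right; elim: i => [|i IHi]; [left | right].
- by right; apply: IHs.
Qed.

Lemma sat_subexpr_or_Delta (A : Type) (I J : set (literal A)) (H phi : expr A)
    (p : seq nat) :
  subexpr_at H p = Some phi -> sat J (reduct I H) ->
  sat J (reduct I phi) \/ sat J (reduct I (Delta H p)).
Proof.
elim: p H => [|i p IHp] H /=; first by case: H => [x|x|s|s] [<-]; left.
case: H => [x|x|s|s] //; case Hi: (onth s i) => [psi|] // psi_phi /=;
  (* Fusing the two maps lets the list lemmas apply with [P] being satisfaction in [J] of the reduct
     by [I]. *)
  rewrite -map_comp => sat_s.
- exact: IHp psi_phi (foldr_and_onth _ _ _ _ _ sat_s Hi).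
- rewrite -map_comp.
  (* If [psi] holds, the induction hypothesis gives [phi] or [Delta psi p], the new entry at [i];
     otherwise a disjunct untouched by the replacement holds. *)
  have [/(IHp _ psi_phi)[|sat_Delta]|] :=
    foldr_or_set_nth _ _ _ _ (Elem Bot) _ (Delta psi p) sat_s Hi.
  + by left.
  + by right; apply: foldr_or_set_nth_id.
  + by right.
Qed.

Theorem theorem2 (A : Type) (H : expr A) (p : seq nat) (h : elementary A)
    (H_Horn : positive_Horn H) (h_occ : positive_occurrence H p h)
    (I : set (literal A)) (I_interp : interpretation I) :
  entails (reduct I H) (reduct I (Or [:: Elem h; Delta H p])).
Proof.
move=> J _ sat_H; have [_ h_at_p] := h_occ.
by case: (sat_subexpr_or_Delta _ _ _ _ _ _ h_at_p sat_H); [left | right; left].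
Qed.
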